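(* Let $(M,\mathcal Q,g,\nabla^T)$ be a quaternionic Kähler manifold with torsion (QKT manifold) with QKT connection $\nabla^T$, and let $\nabla^0$ be a torsion-free quaternionic connection on $(M,\mathcal Q)$. Then the structures $I_1^{\nabla^T}$ and $I_1^{\nabla^0}$ on the twistor space $Z$ of $(M,\mathcal Q)$ coincide.
   Context: An almost quaternionic structure on a $4n$-dimensional manifold $M$ ($n\ge 1$) is a rank-3 subbundle $\mathcal Q\subset \mathrm{End}(TM)$ which is locally spanned by triples $(J_1,J_2,J_3)$ of almost complex structures with $J_\alpha^2=-\mathrm{id}$ and $J_1J_2=-J_2J_1=J_3$; such a local triple is called an admissible basis of $\mathcal Q$. A quaternionic connection is a linear connection $\nabla$ on $TM$ preserving $\mathcal Q$, i.e. $\nabla_X\sigma\in\Gamma(\mathcal Q)$ for every vector field $X$ and every $\sigma\in\Gamma(\mathcal Q)$. An almost quaternionic Hermitian manifold $(M,\mathcal Q,g)$ is an almost quaternionic manifold with a Riemannian metric $g$ which is Hermitian with respect to every almost complex structure in $\mathcal Q$. $(M,\mathcal Q,g)$ is called quaternionic Kähler with torsion (QKT) if there exists a quaternionic connection $\nabla^T$ with $\nabla^Tg=0$ whose torsion tensor $T$ is such that $T(X,Y,Z):=g(T(X,Y),Z)$ is totally skew-symmetric and of type $(1,2)+(2,1)$ with respect to each $J_a$ of every local admissible basis, i.e. $$T(X,Y,Z)=T(J_aX,J_aY,Z)+T(J_aX,Y,J_aZ)+T(X,J_aY,J_aZ),\quad a=1,2,3.$$ Such a $\nabla^T$ is called a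 QKT connection. Twistor space: $Z=\{J\in\mathcal Q: J^2=-\mathrm{id}\}$, i.e. the $S^2$-bundle $\pi:Z\to M$ whose elements are locally $J=a_1J_1+a_2J_2+a_3J_3$ with $a_1^2+a_2^2+a_3^2=1$. For $J\in Z$ with $\pi(J)=x$, the vertical space is $V_J=\ker \pi_{*}=\{W\in\mathcal Q_x: WJ+JW=0\}$. A quaternionic connection $\nabla$ induces a connection on the vector bundle $\mathcal Q$ which preserves $Z$, hence a horizontal distribution $H$ on $Z$ with $T_JZ=V_J\oplus H_J$ and $\pi_*:H_J\to T_xM$ an isomorphism. For $Y\in T_xM$ let $Y^h\in H_J$ denote its horizontal lift. The almost complex structure $I_1^\nabla$ on $Z$ is defined at $J\in Z$ by $I_1^\nabla(W)=JW$ for $W\in V_J$ and $I_1^\nabla(Y^h)=(JY)^h$ for $Y\in T_xM$. *)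

(* Defs.v *)
From HB Require Import structures.
From mathcomp Require Import all_boot all_order all_algebra.
From mathcomp Require Import all_classical all_reals all_analysis.
Set Implicit Arguments.
Unset Strict Implicit.
Unset Printing Implicit Defensive.
Import Order.TTheory GRing.Theory Num.Theory.
Import numFieldNormedType.Exports.
Local Open Scope classical_set_scope.
Local Open Scope ring_scope.

(* C^infinity on an open set A: all iterated directional derivatives of f,
   including f itself, are (Frechet) differentiable at every point of A. *)
Definition smooth_on (R : realType) (V W : normedModType R)
    (A : set V) (f : V -> W) : Prop :=
  forall (s : seq V) (x : V), A x ->
    differentiable (foldr (fun (v : V) (g : V -> W) (y : V) => 'D_v g y) f s) x.

(* [coord] and [param] are total functions, meaningful only on [source] and
   [target], between which they are mutually inverse homeomorphisms. *)
Record chart (R : realType) (m : nat) (T : topologicalType) := Chart {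
  source : set T;
  target : set 'cV[R]_m;
  coord : T -> 'cV[R]_m;
  param : 'cV[R]_m -> T;
  source_open : open source;
  target_open : open target;
  coord_target : forall x, source x -> target (coord x);
  param_source : forall u, target u -> source (param u);
  coordK : forall x, source x -> param (coord x) = x;
  paramK : forall u, target u -> coord (param u) = u;
  coord_continuous : forall x, source x -> {for x, continuous coord};
  param_continuous : forall u, target u -> {for u, continuous param}
}.

Definition region (R : realType) (m : nat) (T : topologicalType)
    (c : chart R m T) (A : set T) : set 'cV[R]_m :=
  [set u | target c u /\ A (param c u)].

(* Each point x carries a preferred chart [chart_at x] of the atlas.  It is
   only used to represent T_x M concretely, and is otherwise arbitrary. *)
Record manifold (R : realType) (m : nat) := Manifold {
  space :> topologicalType;
  space_hausdorff : hausdorff_space space;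
  space_second_countable : @second_countable space;
  atlas : set (chart R m space);
  chart_at : space -> chart R m space;
  chart_at_atlas : forall x, atlas (chart_at x);
  chart_at_source : forall x, source (chart_at x) x;
  atlas_compatible : forall c c', atlas c -> atlas c' ->
    smooth_on (region c (source c')) (coord c' \o param c)
}.

Section Tensors.
Variables (R : realType) (m : nat) (M : manifold R m).
Implicit Types (W : set M) (x y : M) (c : chart R m M).

(* T_x M is 'cV[R]_m, a vector being given by its components in the chart
   [chart_at x]; accordingly End(T_x M) is 'M[R]_m acting by [*m].  Vector
   fields, endomorphism fields and metrics are thus functions on M, whose
   smoothness has to be tested on their components in the charts of the
   atlas. *)

(* Jacobian matrix at y of the change from [chart_at y] to c; it converts a
   tangent vector at y to its components in the chart c. *)
Definition frame c y : 'M[R]_m :=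
  \matrix_(i, j) ('D_(delta_mx j 0) (coord c \o param (chart_at y))
                    (coord (chart_at y) y)) i 0.

Definition vec_rep c (X : M -> 'cV[R]_m) (u : 'cV[R]_m) : 'cV[R]_m :=
  frame c (param c u) *m X (param c u).

Definition endo_comp c y (A : 'M[R]_m) : 'M[R]_m :=
  frame c y *m A *m invmx (frame c y).

Definition endo_rep c (s : M -> 'M[R]_m) (u : 'cV[R]_m) : 'M[R]_m :=
  endo_comp c (param c u) (s (param c u)).

Definition metric_rep c (g : M -> 'M[R]_m) (u : 'cV[R]_m) : 'M[R]_m :=
  (invmx (frame c (param c u)))^T *m g (param c u)
    *m invmx (frame c (param c u)).

Definition smooth_fun W (f : M -> R) : Prop :=
  forall c, atlas c -> smooth_on (region c W) (f \o param c).

Definition smooth_vec W (X : M -> 'cV[R]_m) : Prop :=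
  forall c, atlas c -> smooth_on (region c W) (vec_rep c X).

Definition smooth_endo W (s : M -> 'M[R]_m) : Prop :=
  forall c, atlas c -> smooth_on (region c W) (endo_rep c s).

(* v f, for v in T_x M. *)
Definition deriv_fun x (v : 'cV[R]_m) (f : M -> R) : R :=
  'D_v (f \o param (chart_at x)) (coord (chart_at x) x).

(* [X, Y]_x, by the usual formula X^j d_j Y^i - Y^j d_j X^i in [chart_at x]. *)
Definition bracket (X Y : M -> 'cV[R]_m) x : 'cV[R]_m :=
  'D_(X x) (vec_rep (chart_at x) Y) (coord (chart_at x) x)
  - 'D_(Y x) (vec_rep (chart_at x) X) (coord (chart_at x) x).

(* A linear connection on TM as a covariant derivative acting on local smooth
   sections: [nabla x v Y] is (nabla_v Y)_x for v in T_x M and Y a vector field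
   smooth near x.  Its value depends only on the germ of Y at x, by the
   Leibniz rule applied to the characteristic function of a neighbourhood of
   x. *)
Record connection := Connection {
  nabla : M -> 'cV[R]_m -> (M -> 'cV[R]_m) -> 'cV[R]_m;
  nabla_linear : forall W x (a : R) (v w : 'cV[R]_m) Y,
    open W -> W x -> smooth_vec W Y ->
    nabla x (a *: v + w) Y = a *: nabla x v Y + nabla x w Y;
  nabla_add : forall W x (v : 'cV[R]_m) Y Y',
    open W -> W x -> smooth_vec W Y -> smooth_vec W Y' ->
    nabla x v (fun y => Y y + Y' y) = nabla x v Y + nabla x v Y';
  nabla_leibniz : forall W x (v : 'cV[R]_m) f Y,
    open W -> W x -> smooth_fun W f -> smooth_vec W Y ->
    nabla x v (fun y => f y *: Y y)
      = deriv_fun x v f *: Y x + f x *: nabla x v Y;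
  nabla_smooth : forall W X Y,
    open W -> smooth_vec W X -> smooth_vec W Y ->
    smooth_vec W (fun y => nabla y (X y) Y)
}.

Definition torsion (D : connection) (X Y : M -> 'cV[R]_m) x : 'cV[R]_m :=
  nabla D x (X x) Y - nabla D x (Y x) X - bracket X Y x.

Definition torsion_free (D : connection) : Prop :=
  forall W X Y, open W -> smooth_vec W X -> smooth_vec W Y ->
    forall x, W x -> torsion D X Y x = 0.

(* (nabla_v s)_x = B for the connection induced on End(TM):
   nabla_v (s Y) = (nabla_v s) Y + s (nabla_v Y) for all local Y.  As Y x is
   arbitrary, B is unique. *)
Definition is_nabla_endo (D : connection) x (v : 'cV[R]_m)
    (s : M -> 'M[R]_m) (B : 'M[R]_m) : Prop :=
  forall W Y, open W -> W x -> smooth_vec W Y ->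
    nabla D x v (fun y => s y *m Y y) = B *m Y x + s x *m nabla D x v Y.

Definition inner (g : M -> 'M[R]_m) x (v w : 'cV[R]_m) : R :=
  (v^T *m g x *m w) 0 0.

Definition riemannian (g : M -> 'M[R]_m) : Prop :=
  [/\ forall c, atlas c -> smooth_on (target c) (metric_rep c g),
      forall x v w, inner g x v w = inner g x w v &
      forall x v, v != 0 -> 0 < inner g x v v].

Definition metric_connection (D : connection) (g : M -> 'M[R]_m) : Prop :=
  forall W X Y, open W -> smooth_vec W X -> smooth_vec W Y ->
    forall x (v : 'cV[R]_m), W x ->
      deriv_fun x v (fun y => inner g y (X y) (Y y))
        = inner g x (nabla D x v X) (Y x) + inner g x (X x) (nabla D x v Y).

Definition torsion3 (D : connection) (g : M -> 'M[R]_m)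
    (X Y Z : M -> 'cV[R]_m) x : R :=
  inner g x (torsion D X Y x) (Z x).

End Tensors.

Section Quaternionic.
Variables (R : realType) (m : nat) (M : manifold R m).
Implicit Types (W : set M) (Q : M -> set 'M[R]_m) (x y : M).

Definition section_of Q W (s : M -> 'M[R]_m) : Prop :=
  smooth_endo W s /\ forall y, W y -> Q y (s y).

(* J 0, J 1, J 2 are J_1, J_2, J_3; the relations force them to be linearly
   independent when m > 0, so that Q has rank 3. *)
Definition admissible_basis Q W (J : 'I_3 -> M -> 'M[R]_m) : Prop :=
  [/\ forall a, smooth_endo W (J a),
      forall y, W y -> forall a, J a y *m J a y = - 1%:M,
      forall y, W y ->
        J 0 y *m J 1 y = J 2 y /\ J 1 y *m J 0 y = - J 2 y &
      forall y, W y ->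
        Q y = [set A | exists a : 'I_3 -> R, A = \sum_(i < 3) a i *: J i y]].

Definition almost_quaternionic Q : Prop :=
  forall x, exists W J, [/\ open W, W x & admissible_basis Q W J].

Definition quaternion_hermitian Q (g : M -> 'M[R]_m) : Prop :=
  forall x (J : 'M[R]_m), Q x J -> J *m J = - 1%:M ->
    forall v w, inner g x (J *m v) (J *m w) = inner g x v w.

Definition quaternionic_connection Q (D : connection M) : Prop :=
  forall W s, open W -> section_of Q W s ->
    forall x (v : 'cV[R]_m), W x ->
      exists2 B, Q x B & is_nabla_endo D x v s B.

Definition skew_torsion (D : connection M) (g : M -> 'M[R]_m) : Prop :=
  forall W X Y Z, open W -> smooth_vec W X -> smooth_vec W Y ->
    smooth_vec W Z -> forall x, W x ->
      torsion3 D g X Y Z x = - torsion3 D g Y X Z x /\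
      torsion3 D g X Y Z x = - torsion3 D g X Z Y x.

Definition torsion_type_12_21 Q (D : connection M) (g : M -> 'M[R]_m) : Prop :=
  forall W J, open W -> admissible_basis Q W J ->
  forall (a : 'I_3) X Y Z, smooth_vec W X -> smooth_vec W Y -> smooth_vec W Z ->
  let Ja (V : M -> 'cV[R]_m) := fun y => J a y *m V y in
  forall x, W x ->
    torsion3 D g X Y Z x
      = torsion3 D g (Ja X) (Ja Y) Z x + torsion3 D g (Ja X) Y (Ja Z) x
        + torsion3 D g X (Ja Y) (Ja Z) x.

Definition QKT_connection Q (g : M -> 'M[R]_m) (D : connection M) : Prop :=
  [/\ quaternionic_connection Q D, metric_connection D g,
      skew_torsion D g & torsion_type_12_21 Q D g].

(* The twistor space Z, inside the total space of End(TM). *)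
Definition twistor_space Q : set (M * 'M[R]_m) :=
  [set z | Q z.1 z.2 /\ z.2 *m z.2 = - 1%:M].

(* The tangent space at (x, J) of the total space of End(TM), in the bundle
   chart induced by [chart_at x]: a pair (Y, B) has projection Y to T_x M. *)
Definition tan_endo := ('cV[R]_m * 'M[R]_m)%type.

(* T_J Z: velocities at 0 of the smooth curves of End(TM) lying in Z. *)
Definition tangent_twistor Q (z : M * 'M[R]_m) : set tan_endo :=
  let c := chart_at z.1 in
  [set U | exists (e : R) (gam : R -> M) (A : R -> 'M[R]_m),
    let u (t : R) : 'cV[R]_m := coord c (gam t) in
    let B (t : R) : 'M[R]_m := endo_comp c (gam t) (A t) in
    [/\ 0 < e /\ (forall t : R, `|t| < e ->
           source c (gam t) /\ twistor_space Q (gam t, A t)),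
        smooth_on [set t : R | `|t| < e] u,
        smooth_on [set t : R | `|t| < e] B,
        gam 0 = z.1 /\ A 0 = z.2 &
        U = ('D_1 u 0, 'D_1 B 0)]].

(* V_J, as a subspace of Q_x; [vert] is its inclusion in T_J Z, onto the kernel
   of the differential of the projection to M. *)
Definition vertical Q (z : M * 'M[R]_m) : set 'M[R]_m :=
  [set B | Q z.1 B /\ B *m z.2 + z.2 *m B = 0].

Definition vert (B : 'M[R]_m) : tan_endo := (0, B).

(* ds_x(Y), for s a section of End(TM) smooth near x. *)
Definition diff_section (s : M -> 'M[R]_m) x (Y : 'cV[R]_m) : tan_endo :=
  (Y, 'D_Y (endo_rep (chart_at x) s) (coord (chart_at x) x)).

(* H_J: the vectors ds_x(Y), for Y in T_x M and s a local section of Q through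
   J with nabla_Y s = 0 at x. *)
Definition horizontal Q (D : connection M) (z : M * 'M[R]_m) : set tan_endo :=
  [set U | exists W s Y,
    [/\ open W /\ W z.1, section_of Q W s, s z.1 = z.2,
        is_nabla_endo D z.1 Y s 0 & U = diff_section s z.1 Y]].

(* Y^h, the element of H_J over Y (it exists, and
   is unique, if D is quaternionic and J is in Q). *)
Definition hlift Q (D : connection M) (z : M * 'M[R]_m) (Y : 'cV[R]_m) :
    tan_endo :=
  xget 0 [set U : tan_endo | horizontal Q D z U /\ U.1 = Y].

(* I_1 at z = (x, J) maps B + Y^h to J B + (J Y)^h; the decomposition of a
   vector of T_J Z exists and is unique if D is quaternionic. *)
Definition I1 Q (D : connection M) (z : M * 'M[R]_m) (U : tan_endo) :
    tan_endo :=
  xget 0 [set U' : tan_endo | exists (B : 'M[R]_m) (Y : 'cV[R]_m),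
    [/\ vertical Q z B, U = vert B + hlift Q D z Y &
        U' = vert (z.2 *m B) + hlift Q D z (z.2 *m Y)]].

End Quaternionic.

(* Main.v *)
Require Import Defs.
From HB Require Import structures.
From mathcomp Require Import all_boot all_order all_algebra.
From mathcomp Require Import all_classical all_reals all_analysis.
From mathcomp Require Import ring lra.
Import Defs.
Set Implicit Arguments.
Unset Strict Implicit.
Unset Printing Implicit Defensive.
Import Order.TTheory GRing.Theory Num.Theory.
Import numFieldNormedType.Exports.
Local Open Scope classical_set_scope.
Local Open Scope ring_scope.

(** Let J be a point of the twistor space over x, extended to a local section
    s of Q with square -1 that is the first member of an admissible basis.
    Write phi v for the difference of the covariant derivatives of s along v
    at x, for the torsion connection and for the torsion-free one.  Horizontal
    lifts at J of the two connections differ by the vertical vector - phi v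
    ([hliftE]), so the two almost complex structures agree as soon as
    phi (J v) = J (phi v) for all v ([eq_I1]).

    This complex linearity is where the torsion enters.  For A the difference of
    the two connections, A_X Y - A_Y X is the torsion T, since the other
    connection is torsion-free.  For T of type (1,2)+(2,1), the expression
      T(X, Y) - T(JX, JY) + J T(JX, Y) + J T(X, JY)
    vanishes ([torsion_type_vec]); writing T in terms of A, all
    terms cancel but those in which s is differentiated, and what is left says
    that psi v = phi (J v) - J (phi v) satisfies (psi v) w = (psi w) v
    ([difference_symmetric]).  Now psi v is vertical, that is, an imaginary
    quaternion orthogonal to J.  Taking w = K v, with K the second member of
    the basis, psi v K lies in the span of 1 and J, and psi w in the span of K
    and JK; a nonzero quaternion being injective, both vanish
    ([imag_anticomm_eq0]).

    The type condition concerns the members of admissible bases, so a basis has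
    to be rotated to have J as first member ([admissible_basis_through]).

    Vector fields with prescribed value at x are taken constant in a chart.
    That they are smooth in all the charts of the atlas rests on the closure of
    smooth maps, as defined by iterated directional derivatives, under products
    and composition ([smooth_on_comp]). *)

(** * Calculus of smooth maps *)

Section Locality.
Variables (R : realType) (V W : normedModType R).

(** The differential of f is a differential of g, the remainders being equal
    near x. *)
Lemma near_eq_differentiable (f g : V -> W) (x : V) :
  (\near x, f x = g x) -> differentiable f x -> differentiable g x.
Proof.
move=> fg df.
have fgx : f x = g x := nbhs_singleton fg.
have E : g \o shift x = cst (g x) + 'd f x +o_ 0 id.
  have /eqaddoP Ef := diff_locally df.
  apply/eqaddoP => e e0; have := Ef e e0; move: fg.
  rewrite (near_shift 0) subr0 => fg' Efe.
  apply: filterS2 fg' Efe => h /= fgh Efh.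
  have -> : (g \o shift x - (cst (g x) + 'd f x)) h =
            (f \o shift x - (cst (f x) + 'd f x)) h.
    rewrite !fctE /= fgx; congr (_ - _).
    exact: esym.
  exact: Efh.
apply/diff_locallyP.
have /= -> := diff_unique (diff_continuous df) E.
by split; [exact: diff_continuous|exact: E].
Qed.

End Locality.

Section SmoothUpto.
Variables (R : realType) (V : normedModType R).

(** Peeling off the innermost derivative instead of the outermost one makes
    the closure properties provable by induction on k. *)
Fixpoint smooth_upto (W : normedModType R) k (A : set V) (f : V -> W) : Prop :=
  (forall x, A x -> differentiable f x) /\
  (if k is k'.+1 then forall v, smooth_upto k' A ('D_v f) else True).

Variables (A : set V) (oA : open A).

Lemma smooth_onP (W : normedModType R) (f : V -> W) :
  smooth_on A f <-> forall k, smooth_upto k A f.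
Proof.
split=> [sf k|sf s].
  elim: k f sf => [|k IH] f sf; split => //; try exact: (sf [::]).
  by move=> v; apply: IH => s x Ax; have := sf (rcons s v) x Ax; rewrite foldr_rcons.
elim/last_ind: s f sf => [|s v IH] f sf x Ax.
  by have [df _] := sf 0%N; exact: df.
by rewrite foldr_rcons; apply: IH => // k; have [_ Df] := sf k.+1; exact: Df.
Qed.

Lemma near_open (P : V -> Prop) x : (forall y, A y -> P y) -> A x -> \near x, P x.
Proof.
move=> AP Ax; have : nbhs x A by exact: open_nbhs_nbhs.
by apply: filterS => y; exact: AP.
Qed.

Lemma eq_smooth_upto (W : normedModType R) k (f g : V -> W) :
  (forall x, A x -> f x = g x) -> smooth_upto k A f -> smooth_upto k A g.
Proof.
elim: k f g => [|k IH] f g fg [df Df].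
  by split => // x Ax; apply: near_eq_differentiable (df x Ax); exact: near_open fg Ax.
split=> [x Ax|v].
  by apply: near_eq_differentiable (df x Ax); exact: near_open fg Ax.
apply: IH (Df v) => x Ax.
by apply: near_eq_derive; exact: near_open fg Ax.
Qed.

Lemma smooth_uptoW (W : normedModType R) k (f : V -> W) :
  smooth_upto k.+1 A f -> smooth_upto k A f.
Proof.
elim: k f => [|k IH] f [df Df]; first by split.
by split => // v; exact: IH.
Qed.

Lemma smooth_upto_cst (W : normedModType R) k (w : W) : smooth_upto k A (cst w).
Proof.
elim: k w => [|k IH] w; split => // v.
by apply: eq_smooth_upto (IH 0) => x _; rewrite derive_cst.
Qed.

Lemma smooth_uptoD (W : normedModType R) k (f g : V -> W) :
  smooth_upto k A f -> smooth_upto k A g -> smooth_upto k A (f + g).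
Proof.
elim: k f g => [|k IH] f g [df Df] [dg Dg]; split => //.
- by move=> x Ax; apply: differentiableD; [exact: df|exact: dg].
- by move=> x Ax; apply: differentiableD; [exact: df|exact: dg].
move=> v; apply: eq_smooth_upto (IH _ _ (Df v) (Dg v)) => x Ax.
by rewrite deriveD //; apply: diff_derivable; [exact: df|exact: dg].
Qed.

Lemma smooth_uptoM k (f g : V -> R) :
  smooth_upto k A f -> smooth_upto k A g -> smooth_upto k A (f * g).
Proof.
elim: k f g => [|k IH] f g sf sg; have [df Df] := sf; have [dg Dg] := sg; split => //.
- by move=> x Ax; apply: differentiableM; [exact: df|exact: dg].
- by move=> x Ax; apply: differentiableM; [exact: df|exact: dg].
move=> v.
apply: eq_smooth_upto (smooth_uptoD (IH _ _ (smooth_uptoW sf) (Dg v))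
                          (IH _ _ (smooth_uptoW sg) (Df v))) => x Ax.
by rewrite deriveM //; apply: diff_derivable; [exact: df|exact: dg].
Qed.

Lemma smooth_upto_sum (W : normedModType R) k n (f : 'I_n -> V -> W) :
  (forall i, smooth_upto k A (f i)) -> smooth_upto k A (\sum_i f i).
Proof.
move=> sf; elim/big_ind: _ => //; first exact: smooth_upto_cst.
exact: smooth_uptoD.
Qed.

End SmoothUpto.

Section Matrices.
Variables (R : realType) (V : normedModType R).

Lemma differentiable_mxP p q (f : V -> 'M[R]_(p, q)) x :
  differentiable f x <-> forall i j, differentiable (fun y => f y i j : R) x.
Proof.
split=> [df i j|df].
  exact: (differentiable_comp df (differentiable_coord _ i j)).
have -> : f = \sum_i \sum_j (fun y => (f y i j : R) *: delta_mx i j).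
  apply/funext => y; rewrite fct_sumE [LHS]matrix_sum_delta.
  by apply: eq_bigr => i _; rewrite fct_sumE.
apply: differentiable_sum => i; apply: differentiable_sum => j.
exact: differentiableZl.
Qed.

Lemma derive_mxE p q (f : V -> 'M[R]_(p, q)) x v i j :
  differentiable f x -> 'D_v (fun y => f y i j : R) x = 'D_v f x i j.
Proof.
by move=> df; rewrite derive_mx ?mxE //; exact: diff_derivable.
Qed.

Variables (A : set V) (oA : open A).

Lemma smooth_upto_mxP p q k (f : V -> 'M[R]_(p, q)) :
  smooth_upto k A f <-> forall i j, smooth_upto k A (fun y => f y i j : R).
Proof.
elim: k f => [|k IH] f.
  split=> [[df _] i j|sf].
    by split => // x Ax; have /differentiable_mxP := df x Ax; exact.
  by split => // x Ax; apply/differentiable_mxP => i j; have [d _] := sf i j; exact: d.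
split=> [[df Df] i j|sf].
  split=> [x Ax|v]; first by have /differentiable_mxP := df x Ax; exact.
  have /IH/(_ i j) := Df v; apply: eq_smooth_upto => // x Ax.
  by rewrite derive_mxE //; exact: df.
have df x : A x -> differentiable f x.
  by move=> Ax; apply/differentiable_mxP => i j; have [d _] := sf i j; exact: d.
split=> // v; apply/IH => i j; have [_ /(_ v)] := sf i j.
by apply: eq_smooth_upto => // x Ax; rewrite derive_mxE //; exact: df.
Qed.

Lemma derive_cVE m (f : 'cV[R]_m -> V) u v : differentiable f u ->
  'D_v f u = \sum_i v i 0 *: 'D_(delta_mx i 0) f u.
Proof.
move=> df; rewrite deriveE // [in LHS](matrix_sum_delta v) linear_sum /=.
apply: eq_bigr => i _; rewrite big_ord1 linearZ /= deriveE //.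
Qed.

End Matrices.

Section Composition.
Variables (R : realType) (V : normedModType R) (m : nat).
Variables (A : set V) (oA : open A) (B : set 'cV[R]_m).
Implicit Types (h : V -> 'cV[R]_m).

Lemma derive_comp (W : normedModType R) (f : 'cV[R]_m -> W) h x v :
  differentiable h x -> differentiable f (h x) ->
  'D_v (f \o h) x = 'D_('D_v h x) f (h x).
Proof.
move=> dh df; rewrite !deriveE //; last exact: differentiable_comp.
by rewrite diff_comp.
Qed.

(** By the chain rule and the finiteness of the dimension, a directional
    derivative of f \o h is a sum of products of derivatives of h with partial
    derivatives of f composed with h. *)
Lemma smooth_upto_comp k (f : 'cV[R]_m -> R) h :
  (forall x, A x -> B (h x)) -> smooth_upto k B f -> smooth_upto k A h ->
  smooth_upto k A (f \o h).
Proof.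
move=> AB; elim: k f => [|k IH] f sf sh; have [df Df] := sf; have [dh Dh] := sh.
  by split => // x Ax; apply: differentiable_comp; [exact: dh|apply: df; exact: AB].
split=> [x Ax|v].
  by apply: differentiable_comp; [exact: dh|apply: df; exact: AB].
have : smooth_upto k A (\sum_i ((fun x => 'D_v h x i 0) * ('D_(delta_mx i 0) f \o h))).
  apply: smooth_upto_sum => // i; apply: smooth_uptoM => //.
    by have /(smooth_upto_mxP oA) := Dh v; exact.
  by apply: IH; [exact: Df|exact: smooth_uptoW].
apply: eq_smooth_upto => // x Ax.
have dfx := df _ (AB _ Ax); have dhx := dh _ Ax.
by rewrite derive_comp // derive_cVE // fct_sumE.
Qed.

End Composition.

Section SmoothOn.
Variables (R : realType) (V : normedModType R) (A : set V) (oA : open A).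
Implicit Types W : normedModType R.

Lemma smooth_onS W (B : set V) (f : V -> W) :
  A `<=` B -> smooth_on B f -> smooth_on A f.
Proof. by move=> AB sf s x /AB; exact: sf. Qed.

Lemma smooth_on_differentiable W (f : V -> W) x :
  smooth_on A f -> A x -> differentiable f x.
Proof. by move=> sf; exact: (sf [::]). Qed.

Lemma eq_smooth_on W (f g : V -> W) :
  (forall x, A x -> f x = g x) -> smooth_on A f -> smooth_on A g.
Proof.
move=> fg /smooth_onP sf; apply/smooth_onP => k.
exact: eq_smooth_upto (sf k).
Qed.

Lemma smooth_on_cst W (w : W) : smooth_on A (cst w).
Proof. by apply/smooth_onP => k; exact: smooth_upto_cst. Qed.

Lemma smooth_onD W (f g : V -> W) :
  smooth_on A f -> smooth_on A g -> smooth_on A (f + g).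
Proof.
move=> /smooth_onP sf /smooth_onP sg; apply/smooth_onP => k.
exact: smooth_uptoD.
Qed.

Lemma smooth_onM (f g : V -> R) :
  smooth_on A f -> smooth_on A g -> smooth_on A (f * g).
Proof.
move=> /smooth_onP sf /smooth_onP sg; apply/smooth_onP => k.
exact: smooth_uptoM.
Qed.

Lemma smooth_on_sum W n (f : 'I_n -> V -> W) :
  (forall i, smooth_on A (f i)) -> smooth_on A (\sum_i f i).
Proof.
move=> sf; elim/big_ind: _ => //; [exact: smooth_on_cst|exact: smooth_onD].
Qed.

Lemma smooth_on_derive W (f : V -> W) v : smooth_on A f -> smooth_on A ('D_v f).
Proof. by move=> sf s x Ax; have := sf (rcons s v) x Ax; rewrite foldr_rcons. Qed.

Lemma smooth_on_mxP p q (f : V -> 'M[R]_(p, q)) :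
  smooth_on A f <-> forall i j, smooth_on A (fun y => f y i j : R).
Proof.
split=> [/smooth_onP sf i j|sf]; apply/smooth_onP => k.
  by have /(smooth_upto_mxP oA) := sf k; exact.
by apply/(smooth_upto_mxP oA) => i j; have /smooth_onP := sf i j; exact.
Qed.

Lemma smooth_on_mulmx p q r (f : V -> 'M[R]_(p, q)) (g : V -> 'M[R]_(q, r)) :
  smooth_on A f -> smooth_on A g -> smooth_on A (fun x => f x *m g x).
Proof.
move=> /smooth_on_mxP sf /smooth_on_mxP sg; apply/smooth_on_mxP => i j.
apply: eq_smooth_on (smooth_on_sum (fun l => smooth_onM (sf i l) (sg l j))) => x _.
by rewrite mxE fct_sumE.
Qed.

Lemma smooth_onZ p q (f : V -> R) (g : V -> 'M[R]_(p, q)) :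
  smooth_on A f -> smooth_on A g -> smooth_on A (fun x => f x *: g x).
Proof.
move=> sf /smooth_on_mxP sg; apply/smooth_on_mxP => i j.
by apply: eq_smooth_on (smooth_onM sf (sg i j)) => x _; rewrite mxE.
Qed.

Lemma smooth_on_id : smooth_on A (@id V).
Proof.
apply/smooth_onP => k.
suff : smooth_upto k A (@id V) by [].
case: k => [|k]; split => // v.
by apply: eq_smooth_upto (smooth_upto_cst oA k v) => // x _; rewrite derive_id.
Qed.

End SmoothOn.

Section Jacobian.
Variables (R : realType) (m : nat).

Lemma smooth_on_comp (V : normedModType R) (A : set V) p q (B : set 'cV[R]_m)
    (f : 'cV[R]_m -> 'M[R]_(p, q)) (h : V -> 'cV[R]_m) :
  open A -> open B -> (forall x, A x -> B (h x)) ->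
  smooth_on B f -> smooth_on A h -> smooth_on A (f \o h).
Proof.
move=> oA oB AB /(smooth_on_mxP oB) sf /smooth_onP sh.
apply/(smooth_on_mxP oA) => i j; apply/smooth_onP => k.
have /smooth_onP/(_ k) sfij := sf i j.
exact: (smooth_upto_comp oA AB sfij (sh k)).
Qed.

Definition jacobian_cV p (f : 'cV[R]_m -> 'cV[R]_p) (u : 'cV[R]_m) : 'M[R]_(p, m) :=
  \matrix_(i, j) ('D_(delta_mx j 0) f u) i 0.

Lemma derive_jacobian p (f : 'cV[R]_m -> 'cV[R]_p) u v :
  differentiable f u -> 'D_v f u = jacobian_cV f u *m v.
Proof.
move=> df; rewrite derive_cVE //; apply/colP => i; rewrite summxE mxE.
by apply: eq_bigr => j _; rewrite !mxE mulrC.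
Qed.

Lemma smooth_on_jacobian p (A : set 'cV[R]_m) (f : 'cV[R]_m -> 'cV[R]_p) :
  open A -> smooth_on A f -> smooth_on A (jacobian_cV f).
Proof.
move=> oA sf; apply/(smooth_on_mxP oA) => i j.
have /(smooth_on_mxP oA) sD := smooth_on_derive (delta_mx j 0) sf.
by apply: (eq_smooth_on oA) (sD i 0) => u _; rewrite mxE.
Qed.

End Jacobian.

(** * Charts and moving frames *)

Section Charts.
Variables (R : realType) (m : nat) (M : manifold R m).
Implicit Types (W : set M) (x y : M) (c : chart R m M).

Lemma region_open c W : open W -> open (region c W).
Proof.
move=> oW; rewrite openE => u [tu Wu]; rewrite /interior.
apply: filterI; first by apply: open_nbhs_nbhs; split => //; exact: target_open.
by apply: (param_continuous tu); apply: open_nbhs_nbhs.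
Qed.

Lemma regionS c W W' : W `<=` W' -> region c W `<=` region c W'.
Proof. by move=> WW' u [tu /WW']. Qed.

Lemma region_coord c W x : source c x -> W x -> region c W (coord c x).
Proof. by move=> cx Wx; split; [exact: coord_target|rewrite coordK]. Qed.

Lemma near_coord c (P : M -> Prop) W x :
  open W -> source c x -> W x -> (forall y, source c y -> W y -> P y) ->
  \forall u \near (coord c x), P (param c u).
Proof.
move=> oW cx Wx WP.
have := open_nbhs_nbhs (conj (region_open oW) (region_coord cx Wx)).
by apply: filterS => u [tu Wu]; apply: WP => //; exact: param_source.
Qed.

Lemma shrink_to_chart W x : open W -> W x -> exists W',
  [/\ open W', W' x, W' `<=` W & W' `<=` source (chart_at x)].
Proof.
move=> oW Wx; exists (W `&` source (chart_at x)); split.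
- by apply: openI => //; exact: source_open.
- by split => //; exact: chart_at_source.
- by move=> y [].
- by move=> y [].
Qed.

(** The chain rule for coord c' \o param c followed by coord c \o param of the
    preferred chart at y. *)
Lemma frame_change c c' y : atlas c -> atlas c' -> source c y -> source c' y ->
  frame c' y = jacobian_cV (coord c' \o param c) (coord c y) *m frame c y.
Proof.
move=> ac ac' cy c'y; have ay := chart_at_atlas y; have sy := chart_at_source y.
have oc : open (source c) by exact: source_open.
have d1 : differentiable (coord c \o param (chart_at y)) (coord (chart_at y) y).
  exact: smooth_on_differentiable (atlas_compatible ay ac) (region_coord sy cy).
have d2 : differentiable (coord c' \o param c) (coord c y).
  exact: smooth_on_differentiable (atlas_compatible ac ac') (region_coord cy c'y).
apply/matrixP => i j; rewrite [LHS]mxE.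
have -> : 'D_(delta_mx j 0) (coord c' \o param (chart_at y)) (coord (chart_at y) y) =
          'D_(delta_mx j 0) ((coord c' \o param c) \o (coord c \o param (chart_at y)))
             (coord (chart_at y) y).
  apply: near_eq_derive.
  have := near_coord oc sy cy (P := fun z => coord c' z = coord c' (param c (coord c z))).
  by apply => z _ cz; rewrite coordK.
rewrite derive_comp //=; last by rewrite coordK.
rewrite coordK // derive_jacobian // !mxE; apply: eq_bigr => k _.
by congr (_ * _); rewrite mxE.
Qed.

Lemma frame_chart_at y : frame (chart_at y) y = 1%:M.
Proof.
have sy := chart_at_source y.
apply/matrixP => i j; rewrite mxE.
rewrite (_ : 'D_ _ _ _ = 'D_(delta_mx j 0) id (coord (chart_at y) y)).
  by rewrite derive_id !mxE andbT.
apply: near_eq_derive.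
have ot : open (target (chart_at y)) by exact: target_open.
have := open_nbhs_nbhs (conj ot (coord_target sy)).
by apply: filterS => u tu /=; rewrite paramK.
Qed.

(** The change of charts from c back to the preferred chart at y provides the
    inverse. *)
Lemma frame_unit c y : atlas c -> source c y -> frame c y \in unitmx.
Proof.
move=> ac cy; have := frame_change ac (chart_at_atlas y) cy (chart_at_source y).
by rewrite frame_chart_at => /esym /mulmx1_unit [].
Qed.

End Charts.

Section SmoothFields.
Variables (R : realType) (m : nat) (M : manifold R m).
Implicit Types (W : set M) (x y : M) (c : chart R m M).
Implicit Types (X Y : M -> 'cV[R]_m) (s : M -> 'M[R]_m) (f : M -> R).

Lemma smooth_vecS W W' X : W `<=` W' -> smooth_vec W' X -> smooth_vec W X.
Proof. by move=> WW' sX c ac; exact: smooth_onS (regionS WW') (sX c ac). Qed.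

Lemma smooth_endoS W W' s : W `<=` W' -> smooth_endo W' s -> smooth_endo W s.
Proof. by move=> WW' ss c ac; exact: smooth_onS (regionS WW') (ss c ac). Qed.

Lemma section_ofS Q W W' s : W `<=` W' -> section_of Q W' s -> section_of Q W s.
Proof.
by move=> WW' [ss Qs]; split=> [|y /WW' /Qs //]; exact: smooth_endoS ss.
Qed.

Lemma smooth_vecD W X Y : open W -> smooth_vec W X -> smooth_vec W Y ->
  smooth_vec W (fun y => X y + Y y).
Proof.
move=> oW sX sY c ac; have oc := @region_open _ _ _ c _ oW.
apply: (eq_smooth_on oc) (smooth_onD oc (sX c ac) (sY c ac)) => u _.
by rewrite /vec_rep mulmxDr.
Qed.

Lemma smooth_vecZ W f X : open W -> smooth_fun W f -> smooth_vec W X ->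
  smooth_vec W (fun y => f y *: X y).
Proof.
move=> oW sf sX c ac; have oc := @region_open _ _ _ c _ oW.
apply: (eq_smooth_on oc) (smooth_onZ oc (sf c ac) (sX c ac)) => u _.
by rewrite /vec_rep scalemxAr.
Qed.

Lemma smooth_vec0 W : open W -> smooth_vec W (fun=> 0).
Proof.
move=> oW c ac; have oc := @region_open _ _ _ c _ oW.
apply: (eq_smooth_on oc) (smooth_on_cst oc 0) => u _.
by rewrite /vec_rep mulmx0.
Qed.

Lemma smooth_vec_sum W n (X : 'I_n -> M -> 'cV[R]_m) : open W ->
  (forall i, smooth_vec W (X i)) -> smooth_vec W (fun y => \sum_i X i y).
Proof.
move=> oW sX; have -> : (fun y => \sum_i X i y) = \sum_i X i.
  by apply/funext => y; rewrite fct_sumE.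
elim/big_ind: _ => // [|X1 X2 s1 s2]; first exact: smooth_vec0.
exact: (smooth_vecD oW s1 s2).
Qed.

(** The inverse frame in the components of s cancels against the frame in
    those of X. *)
Lemma smooth_vec_endo W s X : open W -> smooth_endo W s -> smooth_vec W X ->
  smooth_vec W (fun y => s y *m X y).
Proof.
move=> oW ss sX c ac; have oc := @region_open _ _ _ c _ oW.
apply: (eq_smooth_on oc) (smooth_on_mulmx oc (ss c ac) (sX c ac)) => u [tu _].
rewrite /vec_rep /endo_rep /endo_comp mulmxA mulmxKV ?mulmxA //.
by apply: frame_unit => //; exact: param_source.
Qed.

Lemma smooth_fun_cst W (a : R) : open W -> smooth_fun W (fun=> a).
Proof.
move=> oW c ac; have oc := @region_open _ _ _ c _ oW.
exact: (smooth_on_cst oc (a : R)).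
Qed.

Lemma smooth_funN W f : open W -> smooth_fun W f -> smooth_fun W (fun y => - f y).
Proof.
move=> oW sf c ac; have oc := @region_open _ _ _ c _ oW.
apply: (eq_smooth_on oc) (smooth_onM oc (smooth_on_cst oc (-1 : R)) (sf c ac)).
by move=> u _ /=; rewrite fctE mulN1r.
Qed.

Lemma smooth_endoD W s s' : open W -> smooth_endo W s -> smooth_endo W s' ->
  smooth_endo W (fun y => s y + s' y).
Proof.
move=> oW ss ss' c ac; have oc := @region_open _ _ _ c _ oW.
apply: (eq_smooth_on oc) (smooth_onD oc (ss c ac) (ss' c ac)) => u _.
by rewrite /endo_rep /endo_comp mulmxDr mulmxDl.
Qed.

Lemma smooth_endoZ W f s : open W -> smooth_fun W f -> smooth_endo W s ->
  smooth_endo W (fun y => f y *: s y).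
Proof.
move=> oW sf ss c ac; have oc := @region_open _ _ _ c _ oW.
apply: (eq_smooth_on oc) (smooth_onZ oc (sf c ac) (ss c ac)) => u _.
by rewrite /endo_rep /endo_comp -scalemxAr -scalemxAl.
Qed.

Lemma smooth_endo0 W : open W -> smooth_endo W (fun=> 0).
Proof.
move=> oW c ac; have oc := @region_open _ _ _ c _ oW.
apply: (eq_smooth_on oc) (smooth_on_cst oc 0) => u _.
by rewrite /endo_rep /endo_comp mulmx0 mul0mx.
Qed.

Lemma smooth_endo_sum W n (s : 'I_n -> M -> 'M[R]_m) : open W ->
  (forall i, smooth_endo W (s i)) -> smooth_endo W (fun y => \sum_i s i y).
Proof.
move=> oW ss; have -> : (fun y => \sum_i s i y) = \sum_i s i.
  by apply/funext => y; rewrite fct_sumE.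
elim/big_ind: _ => // [|s1 s2 ss1 ss2]; first exact: smooth_endo0.
exact: (smooth_endoD oW ss1 ss2).
Qed.

Lemma smooth_transition c c' W : atlas c -> atlas c' -> W `<=` source c ->
  smooth_on (region c' W) (coord c \o param c').
Proof.
move=> ac ac' Wc; apply: smooth_onS (atlas_compatible ac' ac).
exact: regionS.
Qed.

(** Real functions are turned into 1 x 1 matrices, for which smoothness of
    compositions is stated. *)
Lemma smooth_fun_chart c W (sigma : 'cV[R]_m -> R) :
  atlas c -> open W -> W `<=` source c -> smooth_on (region c W) sigma ->
  smooth_fun W (sigma \o coord c).
Proof.
move=> ac oW Wc ss c' ac'; have oc' := @region_open _ _ _ c' _ oW.
have oc := @region_open _ _ _ c _ oW.
have ss1 : smooth_on (region c W) (fun u => const_mx (sigma u) : 'cV[R]_1).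
  apply/(smooth_on_mxP oc) => i j.
  by apply: (eq_smooth_on oc) ss => u _; rewrite mxE.
have : smooth_on (region c' W) ((fun u => const_mx (sigma u) : 'cV[R]_1) \o
                                (coord c \o param c')).
  apply: (smooth_on_comp oc' oc) => //; last exact: smooth_transition.
  by move=> u [tu Wu]; apply: region_coord => //; exact: Wc.
move=> /(smooth_on_mxP oc')/(_ 0 0).
by apply: (eq_smooth_on oc') => u _; rewrite mxE.
Qed.

Definition const_field c (w : 'cV[R]_m) : M -> 'cV[R]_m :=
  fun y => invmx (frame c y) *m w.

(** In another chart c', the product of frame c' y with the inverse of frame c y
    is the Jacobian matrix of a change of charts, hence smooth. *)
Lemma smooth_const_field c W w : atlas c -> open W -> W `<=` source c ->
  smooth_vec W (const_field c w).
Proof.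
move=> ac oW Wc c' ac'; have oc' := @region_open _ _ _ c' _ oW.
have oc := @region_open _ _ _ c _ (source_open c').
have sj : smooth_on (region c' W) (jacobian_cV (coord c' \o param c) \o (coord c \o param c')).
  apply: (smooth_on_comp oc' oc).
  - move=> u [tu Wu]; apply: region_coord; first exact: Wc.
    exact: param_source.
  - by apply: smooth_on_jacobian => //; exact: atlas_compatible.
  - exact: smooth_transition.
apply: (eq_smooth_on oc') (smooth_on_mulmx oc' sj (smooth_on_cst oc' w)).
move=> u [tu Wu] /=; have cu := Wc _ Wu; have c'u := param_source tu.
rewrite /vec_rep /const_field (frame_change ac ac' cu c'u) mulmxA mulmxK //.
exact: frame_unit.
Qed.

Lemma const_field_at x w : const_field (chart_at x) w x = w.
Proof. by rewrite /const_field frame_chart_at invmx1 mul1mx. Qed.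

End SmoothFields.

(** * Covariant derivatives *)

Section Connections.
Variables (R : realType) (m : nat) (M : manifold R m).
Implicit Types (W : set M) (x y : M) (c : chart R m M) (D : connection M).
Implicit Types (X Y : M -> 'cV[R]_m) (s : M -> 'M[R]_m) (f : M -> R).

Lemma eq_deriv_fun W x v f f' : open W -> W x -> (forall y, W y -> f y = f' y) ->
  deriv_fun x v f = deriv_fun x v f'.
Proof.
move=> oW Wx ff'; apply: near_eq_derive.
apply: (near_coord (P := fun y => f y = f' y) oW) => //.
  exact: chart_at_source.
by move=> y _; exact: ff'.
Qed.

(** The Leibniz rule for the characteristic function of W: it is locally
    constant on W, and it makes X and Y equal everywhere. *)
Lemma nabla_local D W x v X Y : open W -> W x -> smooth_vec W X -> smooth_vec W Y ->
  (forall y, W y -> X y = Y y) -> nabla D x v X = nabla D x v Y.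
Proof.
move=> oW Wx sX sY XY.
pose chi y : R := if `[< W y >] then 1 else 0.
have chiW y : W y -> chi y = 1 by move=> Wy; rewrite /chi; case: asboolP.
have schi : smooth_fun W chi.
  move=> c ac; have oc := @region_open _ _ _ c _ oW.
  apply: (eq_smooth_on oc) (smooth_on_cst oc (1 : R)) => u [_ Wu].
  by rewrite /= chiW.
have chiE Z : smooth_vec W Z -> nabla D x v (fun y => chi y *: Z y) = nabla D x v Z.
  move=> sZ; rewrite (nabla_leibniz D v oW Wx schi sZ).
  rewrite (eq_deriv_fun v oW Wx chiW) chiW // scale1r.
  rewrite (_ : deriv_fun x v _ = 0) ?scale0r ?add0r //.
  exact: derive_cst.
rewrite -(chiE X) // -(chiE Y) //; congr nabla; apply/funext => y.
by rewrite /chi; case: asboolP => [/XY ->|_] //; rewrite !scale0r.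
Qed.

Lemma nabla_zero D x v : nabla D x v (fun=> 0) = 0.
Proof.
have oT : open [set: M] by exact: openT.
have s0 := smooth_vec0 oT.
have := nabla_leibniz D v oT (I : setT x) (smooth_fun_cst 0 oT) s0.
by under eq_fun do rewrite scaler0; rewrite scaler0 scale0r addr0.
Qed.

Lemma nabla_dir0 D W x X : open W -> W x -> smooth_vec W X -> nabla D x 0 X = 0.
Proof.
move=> oW Wx sX; have := nabla_linear D 1 0 0 oW Wx sX.
by rewrite !scale1r addr0 => /eqP; rewrite -subr_eq0 opprD addNKr oppr_eq0 => /eqP.
Qed.

Lemma nabla_sum D W x v n (X : 'I_n -> M -> 'cV[R]_m) : open W -> W x ->
  (forall i, smooth_vec W (X i)) ->
  nabla D x v (fun y => \sum_i X i y) = \sum_i nabla D x v (X i).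
Proof.
move=> oW Wx sX; have -> : (fun y => \sum_i X i y) = \sum_i X i.
  by apply/funext => y; rewrite fct_sumE.
have : smooth_vec W (\sum_i X i) /\ nabla D x v (\sum_i X i) = \sum_i nabla D x v (X i).
  elim/big_rec2: _ => [|i N Y _ [sY <-]].
    by split; [exact: smooth_vec0|exact: nabla_zero].
  split; first exact: (smooth_vecD oW (sX i) sY).
  exact: (nabla_add D v oW Wx (sX i) sY).
by case.
Qed.

Lemma is_nabla_endo_dir0 D W x s : open W -> W x -> smooth_endo W s ->
  is_nabla_endo D x 0 s 0.
Proof.
move=> oW Wx ss W' Y oW' W'x sY.
have oW2 : open (W `&` W') by exact: openI.
have sY2 : smooth_vec (W `&` W') Y by apply: smooth_vecS sY => ? [].
have ss2 : smooth_endo (W `&` W') s by apply: smooth_endoS ss => ? [].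
rewrite (nabla_dir0 D oW2 _ (smooth_vec_endo oW2 ss2 sY2)) //.
by rewrite (nabla_dir0 D oW2 _ sY2) // mulmx0 mul0mx addr0.
Qed.

Lemma is_nabla_endo_unique D x v s B B' :
  is_nabla_endo D x v s B -> is_nabla_endo D x v s B' -> B = B'.
Proof.
move=> hB hB'; apply/matrixP => i j.
have os := source_open (chart_at x); have xs := chart_at_source x.
pose Y := const_field (chart_at x) (delta_mx j 0).
have sY : smooth_vec (source (chart_at x)) Y.
  exact: smooth_const_field (chart_at_atlas x) os (@subset_refl _ _).
have := hB _ Y os xs sY; rewrite (hB' _ Y os xs sY) => /addIr.
by rewrite /Y const_field_at -!colE => /colP/(_ i); rewrite !mxE.
Qed.

(** The columns of a smooth endomorphism field expand along the constant
    fields of a chart, so the Leibniz rule isolates the derivative of the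
    components of the field. *)
Lemma nabla_const_field D W x v s j : open W -> W x -> smooth_endo W s ->
  W `<=` source (chart_at x) ->
  nabla D x v (fun y => s y *m const_field (chart_at x) (delta_mx j 0) y) =
  col j ('D_v (endo_rep (chart_at x) s) (coord (chart_at x) x)) +
  \sum_i s x i j *: nabla D x v (const_field (chart_at x) (delta_mx i 0)).
Proof.
move=> oW Wx ss Wc; set c := chart_at x; pose E i := const_field c (delta_mx i 0).
have ac : atlas c := chart_at_atlas x; have xc : source c x := chart_at_source x.
have oc := @region_open _ _ _ c _ oW; have sc := ss c ac.
have sE i : smooth_vec W (E i) by exact: smooth_const_field.
pose f i := (fun u => endo_rep c s u i j) \o coord c.
have sf i : smooth_fun W (f i).
  by apply: smooth_fun_chart => //; have /(smooth_on_mxP oc) := sc; exact.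
have fx i : f i x = s x i j.
  by rewrite /f /endo_rep /endo_comp /= coordK // frame_chart_at invmx1 mulmx1 mul1mx.
have df i : deriv_fun x v (f i) = 'D_v (endo_rep c s) (coord c x) i j.
  rewrite -derive_mxE; last by apply: smooth_on_differentiable sc _; exact: region_coord.
  apply: near_eq_derive; have ot : open (target c) by exact: target_open.
  have := open_nbhs_nbhs (conj ot (coord_target xc)).
  by apply: filterS => u tu; rewrite /f /= paramK.
have sfE i : smooth_vec W (fun y => f i y *: E i y) by exact: smooth_vecZ.
rewrite (nabla_local D v oW Wx (smooth_vec_endo oW ss (sE j)) (smooth_vec_sum oW sfE)).
  rewrite (nabla_sum D v oW Wx sfE).
  under eq_bigr do rewrite (nabla_leibniz D v oW Wx (sf _) (sE _)) fx df.
  rewrite big_split /=; congr (_ + _); apply/colP => i; rewrite summxE !mxE.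
  rewrite (bigD1 i) //= big1 ?addr0 => [|k ki].
    by rewrite /E const_field_at !mxE !eqxx mulr1.
  by rewrite /E const_field_at !mxE eq_sym (negPf ki) mulr0.
move=> y Wy; have cy := Wc y Wy; have Fy := frame_unit ac cy.
rewrite /f /E /const_field /= /endo_rep coordK //.
transitivity (invmx (frame c y) *m (endo_comp c y (s y) *m (delta_mx j 0 : 'cV_m))).
  by rewrite /endo_comp -!mulmxA mulKmx.
rewrite -colE [X in _ *m X](_ : _ =
    \sum_i endo_comp c y (s y) i j *: (delta_mx i 0 : 'cV[R]_m)).
  by rewrite mulmx_sumr; apply: eq_bigr => i _; rewrite scalemxAr.
by rewrite [LHS]matrix_sum_delta; apply: eq_bigr => i _; rewrite big_ord1 mxE.
Qed.

(** Two fields with the same value at x differ at first order by a tensor: the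
    difference of their covariant derivatives is that of the derivatives of
    their components. *)
Lemma is_nabla_endo_diff D W x v s s' B B' : open W -> W x ->
  smooth_endo W s -> smooth_endo W s' -> s x = s' x ->
  is_nabla_endo D x v s B -> is_nabla_endo D x v s' B' ->
  'D_v (endo_rep (chart_at x) s) (coord (chart_at x) x)
  - 'D_v (endo_rep (chart_at x) s') (coord (chart_at x) x) = B - B'.
Proof.
move=> oW Wx ss ss' sx hB hB'; set c := chart_at x.
have [W1 [oW1 W1x W1W W1c]] := shrink_to_chart oW Wx.
have key s1 B1 j : smooth_endo W s1 -> is_nabla_endo D x v s1 B1 ->
    col j ('D_v (endo_rep c s1) (coord c x)) =
    col j B1 + (s1 x *m nabla D x v (const_field c (delta_mx j 0)) -
     \sum_i s1 x i j *: nabla D x v (const_field c (delta_mx i 0))).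
  move=> ss1 hB1; have ac : atlas c := chart_at_atlas x.
  have := hB1 _ _ oW1 W1x (smooth_const_field (delta_mx j 0) ac oW1 W1c).
  rewrite (nabla_const_field D v j oW1 W1x (smooth_endoS W1W ss1) W1c).
  by rewrite const_field_at -colE addrA => <-; rewrite addrK.
apply/matrixP => i j.
have /colP/(_ i) := key s B j ss hB; have /colP/(_ i) := key s' B' j ss' hB'.
rewrite sx !mxE => -> ->.
by rewrite opprD addrACA subrr addr0.
Qed.

(** Differentiating s s = -1. *)
Lemma is_nabla_endo_anticomm D W x v s B : open W -> W x -> smooth_endo W s ->
  (forall y, W y -> s y *m s y = - 1%:M) -> is_nabla_endo D x v s B ->
  B *m s x + s x *m B = 0.
Proof.
move=> oW0 W0x ss s2 hB; set c := chart_at x.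
have [W1 [oW Wx W1W Wc]] := shrink_to_chart oW0 W0x.
have ss1 := smooth_endoS W1W ss.
apply/matrixP => i j; pose Y := const_field c (delta_mx j 0).
have sY : smooth_vec W1 Y by apply: smooth_const_field => //; exact: chart_at_atlas.
have Yx : Y x = delta_mx j 0 by exact: const_field_at.
have ssY := smooth_vec_endo oW ss1 sY.
have := hB _ _ oW Wx ssY; rewrite (hB _ _ oW Wx sY) mulmxDr Yx !mulmxA.
rewrite (s2 x W0x) mulNmx mul1mx.
rewrite (@nabla_local _ _ _ _ _ (fun y => (-1) *: Y y) oW Wx).
- rewrite (nabla_leibniz D v oW Wx (smooth_fun_cst (-1) oW) sY).
  rewrite (_ : deriv_fun x v _ = 0) ?scale0r ?add0r; last exact: derive_cst.
  rewrite scaleN1r addrA -[LHS]add0r => /addIr.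
  by rewrite -mulmxDl -colE => /colP/(_ i); rewrite !mxE.
- exact: (smooth_vec_endo oW ss1 ssY).
- by apply: smooth_vecZ => //; exact: smooth_fun_cst.
- by move=> y /W1W Wy; rewrite mulmxA s2 // mulNmx mul1mx scaleN1r.
Qed.

(** Where f vanishes, the Leibniz rule leaves only (v f) t from the derivative
    of f t. *)
Lemma is_nabla_endo_subZ D W x v f s t B : open W -> W x -> smooth_fun W f ->
  smooth_endo W s -> smooth_endo W t -> f x = 0 -> is_nabla_endo D x v s B ->
  is_nabla_endo D x v (fun y => s y - f y *: t y) (B - deriv_fun x v f *: t x).
Proof.
move=> oW Wx sf ss st fx hB W' Y oW' W'x sY.
have oW1 : open (W `&` W') by exact: openI.
have W1x : (W `&` W') x by [].
have W1W : W `&` W' `<=` W by move=> ? [].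
have W1W' : W `&` W' `<=` W' by move=> ? [].
have sY1 := smooth_vecS W1W' sY.
have sf1 : smooth_fun (W `&` W') f.
  by move=> c ac; exact: smooth_onS (regionS W1W) (sf c ac).
have ssY := smooth_vec_endo oW1 (smooth_endoS W1W ss) sY1.
have stY := smooth_vec_endo oW1 (smooth_endoS W1W st) sY1.
have snf := smooth_funN oW1 sf1.
rewrite (_ : (fun y => _) = (fun y => s y *m Y y + (- f y) *: (t y *m Y y))); last first.
  by apply/funext => y; rewrite mulmxBl -scalemxAl scaleNr.
rewrite (nabla_add D v oW1 W1x ssY (smooth_vecZ oW1 snf stY)).
rewrite (nabla_leibniz D v oW1 W1x snf stY) (hB _ _ oW' W'x sY) fx oppr0 !scale0r.
rewrite addr0 subr0 mulmxBl -scalemxAl addrAC; congr (_ + _ + _).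
rewrite -scaleNr; congr (_ *: _).
rewrite /deriv_fun; have xc := chart_at_source x.
have df : differentiable (f \o param (chart_at x)) (coord (chart_at x) x).
  exact: smooth_on_differentiable (sf _ (chart_at_atlas x)) (region_coord xc Wx).
by rewrite -deriveN //; exact: diff_derivable.
Qed.

(** A multiple of a coordinate along which v has a nonzero component, shifted to
    vanish at x. *)
Lemma linear_coord_fun W x (v : 'cV[R]_m) : open W -> W x -> v != 0 ->
  W `<=` source (chart_at x) ->
  exists f, [/\ smooth_fun W f, f x = 0 & deriv_fun x v f = 1].
Proof.
move=> oW Wx v0 Wc; set c := chart_at x.
have [i vi] : exists i, v i 0 != 0.
  apply: contrapT => nv; move/eqP: v0; apply; apply/colP => i; rewrite mxE.
  by apply: contrapT => vi; apply: nv; exists i; apply/eqP.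
have xc : source c x := chart_at_source x.
pose h := (v i 0)^-1 *: (@id 'cV[R]_m - cst (coord c x)).
have oc := @region_open _ _ _ c _ oW.
have sh : smooth_on (region c W) h.
  have sB := smooth_onD oc (smooth_on_id oc) (smooth_on_cst oc (- coord c x)).
  exact: (smooth_onZ oc (smooth_on_cst oc ((v i 0)^-1 : R)) sB).
exists ((fun u => h u i 0) \o coord c); split.
- apply: smooth_fun_chart => //; first exact: chart_at_atlas.
  by have /(smooth_on_mxP oc) := sh; exact.
- by rewrite /h /= !fctE subrr scaler0 mxE.
rewrite (_ : deriv_fun _ _ _ = 'D_v (fun u => h u i 0 : R) (coord c x)); last first.
  apply: near_eq_derive; have ot : open (target c) by exact: target_open.
  have := open_nbhs_nbhs (conj ot (coord_target xc)).
  by apply: filterS => u tu; rewrite /= paramK.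
rewrite derive_mxE; last by apply: smooth_on_differentiable sh _; exact: region_coord.
rewrite /h deriveZ ?deriveB ?derive_id ?derive_cst ?subr0 ?mxE ?mulVf //.
Qed.

End Connections.

(** * Quaternionic linear algebra *)

Section Quaternions.
Variables (R : realType) (m : nat).
Implicit Types (J : 'I_3 -> 'M[R]_m) (a b : 'I_3 -> R).

Lemma sum_ord3 (V : nmodType) (F : 'I_3 -> V) : \sum_i F i = F 0 + F 1 + F 2.
Proof.
rewrite !big_ord_recl big_ord0 addr0 addrA.
by congr (_ + F _ + F _); apply: val_inj.
Qed.

Lemma ord3P (P : 'I_3 -> Prop) : P 0 -> P 1 -> P 2 -> forall i, P i.
Proof.
move=> P0 P1 P2 [[|[|[|//]]] h].
- by rewrite (_ : Ordinal h = 0) //; exact: val_inj.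
- by rewrite (_ : Ordinal h = 1) //; exact: val_inj.
- by rewrite (_ : Ordinal h = 2) //; exact: val_inj.
Qed.

Definition dot3 a b : R := a 0 * b 0 + a 1 * b 1 + a 2 * b 2.

Definition vec3 (p q r : R) : 'I_3 -> R := fun i => [:: p; q; r]`_i.

Lemma vec3E p q r : (vec3 p q r 0 = p) * (vec3 p q r 1 = q) * (vec3 p q r 2 = r).
Proof. by []. Qed.

Definition cross3 a b : 'I_3 -> R :=
  vec3 (a 1 * b 2 - a 2 * b 1) (a 2 * b 0 - a 0 * b 2) (a 0 * b 1 - a 1 * b 0).

(** The imaginary quaternion with coordinates a, for the action of the
    quaternions given by J. *)
Definition imag J a : 'M[R]_m := \sum_i a i *: J i.

Definition quaternion_triple J :=
  [/\ forall i, J i *m J i = - 1%:M, J 0 *m J 1 = J 2 & J 1 *m J 0 = - J 2].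

Lemma imag_mul J a b : quaternion_triple J ->
  imag J a *m imag J b = imag J (cross3 a b) - (dot3 a b)%:M.
Proof.
move=> [JJ J01 J10].
have J12 : J 1 *m J 2 = J 0.
  by rewrite -J01 mulmxA J10 mulNmx -J01 -mulmxA JJ mulmxN mulmx1 opprK.
have J21 : J 2 *m J 1 = - J 0 by rewrite -J01 -mulmxA JJ mulmxN mulmx1.
have J02 : J 0 *m J 2 = - J 1 by rewrite -J01 mulmxA JJ mulNmx mul1mx.
have J20 : J 2 *m J 0 = J 1.
  by rewrite -J01 -mulmxA J10 mulmxN J02 opprK.
rewrite /imag !sum_ord3 !mulmxDl !mulmxDr -!scalemxAl -!scalemxAr !JJ J01 J10 J12 J21 J02 J20.
rewrite -[X in _ = _ - X]scalemx1; move: (1%:M) (J 0) (J 1) (J 2) => I J0 J1 J2.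
rewrite /cross3 /dot3 !vec3E.
by apply/matrixP => i j; rewrite !mxE /=; ring.
Qed.

Lemma orthogonal_unit a : dot3 a a = 1 -> exists b, dot3 a b = 0 /\ dot3 b b = 1.
Proof.
rewrite /dot3 => a1; have [a00|a00] := eqVneq (a 0 ^+ 2 + a 1 ^+ 2) 0.
  have [a0 a1'] : a 0 = 0 /\ a 1 = 0 by split; nra.
  by exists (vec3 1 0 0); rewrite !vec3E a0 a1'; split; ring.
set r := a 0 ^+ 2 + a 1 ^+ 2 in a00 *.
have r0 : 0 < r by rewrite lt_neqAle eq_sym a00 addr_ge0 // sqr_ge0.
have r2 : Num.sqrt r ^+ 2 = r by rewrite sqr_sqrtr // ltW.
have sr0 : Num.sqrt r != 0 by rewrite gt_eqF // sqrtr_gt0.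
exists (vec3 (- a 1 / Num.sqrt r) (a 0 / Num.sqrt r) 0); rewrite !vec3E; split.
  by field.
move: (Num.sqrt r) r2 sr0 => q r2 q0.
by transitivity (r / q ^+ 2); [rewrite /r; field|rewrite r2 divff].
Qed.

(** Rotations act on the imaginary quaternions by automorphisms, because they
    preserve the dot and cross products; and any unit vector is the first row of
    one. *)
Lemma rotate_imag a : dot3 a a = 1 -> exists O : 'M[R]_3,
  [/\ O \in unitmx, O 0 = a & forall J, quaternion_triple J ->
      quaternion_triple (fun k => imag J (O k))].
Proof.
move=> a1; have [b [ab b1]] := orthogonal_unit a1.
pose O : 'M[R]_3 := \matrix_(k, i) (if k == 0 then a else if k == 1 then b else cross3 a b) i.
have O0 : O 0 = a by apply/funext => i; rewrite mxE.
have O1 : O 1 = b by apply/funext => i; rewrite mxE.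
have O2 : O 2 = cross3 a b by apply/funext => i; rewrite mxE.
have c1 : dot3 (cross3 a b) (cross3 a b) = 1.
  transitivity (dot3 a a * dot3 b b - dot3 a b ^+ 2).
    by rewrite /dot3 /cross3 !vec3E; ring.
  by rewrite a1 b1 ab; ring.
have ba : dot3 b a = 0 by rewrite -ab /dot3; ring.
have ca : dot3 (cross3 a b) a = 0 by rewrite /dot3 /cross3 !vec3E; ring.
have cb : dot3 (cross3 a b) b = 0 by rewrite /dot3 /cross3 !vec3E; ring.
have ac : dot3 a (cross3 a b) = 0 by rewrite /dot3 /cross3 !vec3E; ring.
have bc : dot3 b (cross3 a b) = 0 by rewrite /dot3 /cross3 !vec3E; ring.
have OO : O *m O^T = 1%:M.
  have E k l : (O *m O^T) k l = dot3 (O k) (O l).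
    by rewrite mxE sum_ord3 !(mxE trmx_key).
  apply/matrixP => k l; rewrite E [RHS]mxE; move: k l.
  by apply: ord3P; apply: ord3P; rewrite ?O0 ?O1 ?O2.
exists O; split => //; first by have [] := mulmx1_unit OO.
move=> J hJ; have imagN u v : cross3 u v = - cross3 v u.
  apply/funext; apply: ord3P; rewrite /cross3 /vec3 fctE /=; ring.
have dot0 : imag J (fun=> 0) = 0 by rewrite /imag; apply: big1 => i _; rewrite scale0r.
split.
- move=> k; rewrite imag_mul // (_ : cross3 _ _ = fun=> 0).
    rewrite dot0 add0r; congr (- _%:M); move: k.
    by apply: ord3P; rewrite ?O0 ?O1 ?O2.
  by apply/funext; apply: ord3P; rewrite /cross3 !vec3E; ring.
- by rewrite imag_mul // O0 O1 O2 ab raddf0 subr0.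
- rewrite imag_mul // O0 O1 O2 ba raddf0 subr0 imagN /imag -sumrN.
  by apply: eq_bigr => i _; rewrite fctE scaleNr.
Qed.

Lemma scalar_mx_inj0 (a : R) : (0 < m)%N -> a%:M = 0 :> 'M[R]_m -> a = 0.
Proof.
by move=> m0 /matrixP/(_ (Ordinal m0) (Ordinal m0)); rewrite !mxE eqxx mulr1n.
Qed.

Lemma imag_sqr J a : (0 < m)%N -> quaternion_triple J ->
  imag J a *m imag J a = - 1%:M -> dot3 a a = 1.
Proof.
move=> m0 hJ; rewrite imag_mul // (_ : cross3 _ _ = fun=> 0); last first.
  by apply/funext; apply: ord3P; rewrite /cross3 !vec3E; ring.
rewrite [imag J _]big1 => [|i _]; last by rewrite scale0r.
rewrite add0r => /oppr_inj /eqP; rewrite -subr_eq0 -raddfB /= => /eqP.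
by move=> /(scalar_mx_inj0 m0) /eqP; rewrite subr_eq0 => /eqP.
Qed.

(** The anticommutator of two imaginary quaternions is -2 times their dot
    product. *)
Lemma imag_anticomm J a : (0 < m)%N -> quaternion_triple J ->
  imag J a *m J 0 + J 0 *m imag J a = 0 -> a 0 = 0.
Proof.
move=> m0 hJ; have -> : J 0 = imag J (vec3 1 0 0).
  by rewrite /imag sum_ord3 !vec3E scale1r !scale0r !addr0.
rewrite !imag_mul // addrACA [X in X + _](_ : _ = 0).
  rewrite add0r -opprD => /eqP; rewrite oppr_eq0 -raddfD /= => /eqP.
  by move=> /(scalar_mx_inj0 m0); rewrite /dot3 !vec3E; lra.
rewrite /imag -big_split big1 //= => i _; rewrite -scalerDl.
rewrite (_ : _ + _ = 0) ?scale0r //; move: i.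
by apply: ord3P; rewrite /cross3 !vec3E; ring.
Qed.

(** Since A and B are imaginary and orthogonal to J 0, the product of A and J 1
    is in the span of 1 and J 0, and B is in that of J 1 and J 2.  So the
    quaternion by which their actions on v differ has the coefficients of both A
    and B, up to sign, and it vanishes because a nonzero quaternion is
    injective. *)
Lemma imag_anticomm_eq0 J A B (v : 'cV[R]_m) : (0 < m)%N -> quaternion_triple J ->
  (exists a, A = imag J a) -> (exists b, B = imag J b) ->
  A *m J 0 + J 0 *m A = 0 -> B *m J 0 + J 0 *m B = 0 ->
  v != 0 -> A *m (J 1 *m v) = B *m v -> A = 0.
Proof.
move=> m0 hJ [a ->] [b ->] /(imag_anticomm m0 hJ) a0 /(imag_anticomm m0 hJ) b0 v0.
have J1 : J 1 = imag J (vec3 0 1 0).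
  by rewrite /imag sum_ord3 !vec3E scale1r !scale0r add0r addr0.
rewrite mulmxA {1}J1 imag_mul // => h.
(* (a 1)%:M + imag J c is B minus the product of A and J 1. *)
pose c := vec3 (a 2) (b 1) (b 2).
have h1 : ((a 1)%:M + imag J c) *m v = 0.
  apply: oppr_inj; rewrite oppr0 -mulNmx.
  rewrite -[RHS](subrr (imag J b *m v)) -{1}h -mulmxBl; congr (_ *m _).
  rewrite (_ : dot3 _ _ = a 1); last by rewrite /dot3 !vec3E; ring.
  rewrite opprD addrAC addrC; congr (_ + _).
  rewrite /imag -sumrB -sumrN; apply: eq_bigr => i _; rewrite -scalerBl -scaleNr.
  congr (_ *: _); move: i.
  by apply: ord3P; rewrite /c /cross3 !vec3E ?a0 ?b0; ring.
(* Multiply by the conjugate quaternion. *)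
have h2 : (a 1 ^+ 2 + dot3 c c) *: v = 0.
  rewrite -[RHS](mulmx0 _ ((a 1)%:M - imag J c)) -h1 mulmxA; rewrite -mul_scalar_mx.
  congr (_ *m _).
  rewrite mulmxDr !mulmxBl -!scalar_mxM imag_mul // !mul_scalar_mx !mul_mx_scalar.
  rewrite [imag J (cross3 c c)](_ : _ = 0); last first.
    rewrite /imag big1 // => i _; rewrite (_ : cross3 _ _ _ = 0) ?scale0r //.
    by move: i; apply: ord3P; rewrite /cross3 !vec3E; ring.
  by rewrite add0r opprK raddfD /= expr2 addrA subrK.
have h3 : a 1 ^+ 2 + dot3 c c = 0.
  by apply/eqP; move/eqP: h2; rewrite scaler_eq0 (negPf v0) orbF.
have [a10 a20] : a 1 = 0 /\ a 2 = 0.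
  by move: h3; rewrite /dot3 /c !vec3E; split; nra.
by rewrite /imag sum_ord3 a0 a10 a20 !scale0r !addr0.
Qed.

End Quaternions.

(** * Horizontal lifts in the twistor space *)

Section Twistor.
Variables (R : realType) (m : nat) (M : manifold R m).
Variable Q : M -> set 'M[R]_m.
Implicit Types (W : set M) (x y : M) (c : chart R m M) (D : connection M).
Implicit Types (X Y : M -> 'cV[R]_m) (s : M -> 'M[R]_m) (J : 'I_3 -> M -> 'M[R]_m).

Lemma admissible_triple W J y : admissible_basis Q W J -> W y ->
  quaternion_triple (J ^~ y).
Proof.
move=> [_ JJ J01 _] Wy; have [h01 h10] := J01 y Wy.
by split => // i; exact: JJ.
Qed.

Lemma imag_linear (I : 'I_3 -> 'M[R]_m) k (a b : 'I_3 -> R) :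
  imag I (fun i => a i + k * b i) = imag I a + k *: imag I b.
Proof.
rewrite /imag scaler_sumr -big_split; apply: eq_bigr => i _ /=.
by rewrite scalerDl scalerA.
Qed.

Lemma section_imag W J (a : 'I_3 -> R) : open W -> admissible_basis Q W J ->
  section_of Q W (fun y => imag (J ^~ y) a).
Proof.
move=> oW [sJ _ _ QJ]; split; last by move=> y Wy; rewrite QJ //; exists a.
apply: smooth_endo_sum => // i; apply: smooth_endoZ => //.
exact: smooth_fun_cst.
Qed.

Lemma section_subZ W J f s t : open W -> admissible_basis Q W J ->
  smooth_fun W f -> section_of Q W s -> section_of Q W t ->
  section_of Q W (fun y => s y - f y *: t y).
Proof.
move=> oW [_ _ _ QJ] sf [ss Qs] [st Qt]; split.
  have snf := smooth_funN oW sf.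
  have := smooth_endoD oW ss (smooth_endoZ oW snf st).
  by congr smooth_endo; apply/funext => y; rewrite scaleNr.
move=> y Wy; have := Qs y Wy; have := Qt y Wy; rewrite QJ // => -[b tb] [a sa].
exists (fun i => a i + (- f y) * b i); rewrite sa tb -scaleNr.
exact: (esym (imag_linear (J ^~ y) (- f y) a b)).
Qed.

Lemma admissible_basisS W W' J : W `<=` W' -> admissible_basis Q W' J ->
  admissible_basis Q W J.
Proof.
move=> WW' [sJ JJ J01 QJ]; split=> [a||y|y].
- exact: smooth_endoS (sJ a).
- by move=> y /WW'; exact: JJ.
- by move=> /WW'; exact: J01.
- by move=> /WW'; exact: QJ.
Qed.

(** The coordinates of A in an admissible basis form a unit vector, as A squares
    to -1, so a constant rotation of the basis brings A to the first place. *)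
Lemma admissible_basis_through x (A : 'M[R]_m) : (0 < m)%N ->
  almost_quaternionic Q -> Q x A -> A *m A = - 1%:M ->
  exists W J, [/\ open W, W x, admissible_basis Q W J & J 0 x = A].
Proof.
move=> m0 hQ; have [W [J [oW Wx hJ]]] := hQ x => QA A2.
have [sJ JJ J01 QJ] := hJ.
have [a Aa] : exists a, A = imag (J ^~ x) a by move: QA; rewrite QJ.
have a1 : dot3 a a = 1.
  by apply: (imag_sqr m0 (admissible_triple hJ Wx)); rewrite -Aa.
have [N [Nu N0 hN]] := rotate_imag m a1.
exists W, (fun k y => imag (J ^~ y) (N k)); split => //; last by rewrite N0 Aa.
have hN' y (Wy : W y) := hN _ (admissible_triple hJ Wy).
split.
- by move=> k; have [] := section_imag (N k) oW hJ.
- by move=> y Wy k; have [] := hN' y Wy.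
- by move=> y Wy; have [] := hN' y Wy.
move=> y Wy; rewrite QJ //; apply/seteqP; split => B [b ->] /=.
  pose d : 'rV[R]_3 := (\row_i b i) *m invmx N.
  exists (d 0); rewrite /imag; under [RHS]eq_bigr do rewrite scaler_sumr.
  rewrite exchange_big /=; apply: eq_bigr => i _.
  have -> : b i = (d *m N) 0 i by rewrite /d mulmxKV // mxE.
  by rewrite mxE scaler_suml; apply: eq_bigr => k _; rewrite scalerA.
exists (fun i => \sum_k b k * N k i).
rewrite /imag; under eq_bigr do rewrite scaler_sumr.
rewrite exchange_big /=; apply: eq_bigr => i _.
by rewrite scaler_suml; apply: eq_bigr => k _; rewrite scalerA.
Qed.

(** A section through s z.1 with zero derivative along v is s - f t, for t a
    section through B and f a function with f z.1 = 0 and v f = 1.  All such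
    sections have the same differential along v, by [is_nabla_endo_diff]. *)
Lemma hliftE D W J z s v B : open W -> W z.1 -> admissible_basis Q W J ->
  section_of Q W s -> s z.1 = z.2 -> Q z.1 B -> is_nabla_endo D z.1 v s B ->
  hlift Q D z v = diff_section s z.1 v - vert B.
Proof.
case: z => x A /= oW0 W0x hJ0 ss0 sx QB hB.
have [W1 [oW Wx W1W Wc]] := shrink_to_chart oW0 W0x.
have hJ := admissible_basisS W1W hJ0; have ss := section_ofS W1W ss0.
have [U [hU UE]] : exists U, horizontal Q D (x, A) U /\ U.1 = v.
  have [v0|v0] := eqVneq v 0.
    have B0 : B = 0.
      apply: is_nabla_endo_unique hB _; rewrite v0.
      exact: is_nabla_endo_dir0 oW Wx ss.1.
    exists (diff_section s x v); split => //.
    by exists W1, s, v; split => //; rewrite -B0.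
  have [f [sf fx df]] := linear_coord_fun oW Wx v0 Wc.
  have [b Bb] : exists b, B = imag (J ^~ x) b.
    by have [_ _ _ QJ] := hJ; move: QB; rewrite QJ.
  have st := section_imag b oW hJ.
  exists (diff_section (fun y => s y - f y *: imag (J ^~ y) b) x v); split => //.
  exists W1, (fun y => s y - f y *: imag (J ^~ y) b), v; split => //=.
  - exact: section_subZ hJ sf ss st.
  - by rewrite fx scale0r subr0.
  - have := is_nabla_endo_subZ oW Wx sf ss.1 st.1 fx hB.
    by rewrite df scale1r -Bb subrr.
rewrite /hlift; case: xgetP => [U' _ [hU' U'v]|/(_ U)]; last by case.
have [W' [s' [Y [[oW' W'x] [ss' _] s'x hs' U'E]]]] := hU'.
have {}U'v : Y = v by rewrite -U'v U'E.
subst Y.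
have oW2 : open (W1 `&` W') by exact: openI.
have W2W : W1 `&` W' `<=` W1 by move=> ? [].
have W2W' : W1 `&` W' `<=` W' by move=> ? [].
have E : s' x = s x by rewrite s'x sx.
have := is_nabla_endo_diff oW2 (conj Wx W'x) (smooth_endoS W2W' ss')
  (smooth_endoS W2W ss.1) E hs' hB.
rewrite sub0r => /eqP; rewrite subr_eq => /eqP dE.
rewrite U'E /diff_section /vert dE.
by congr pair; rewrite /= ?subr0 // addrC.
Qed.

Lemma vertD (A B : 'M[R]_m) : vert (A + B) = vert A + vert B.
Proof. by rewrite /vert; congr pair; rewrite /= ?addr0. Qed.

Lemma vertN (A : 'M[R]_m) : vert (- A) = - vert A.
Proof. by rewrite /vert; congr pair; rewrite /= ?oppr0. Qed.

(** The decompositions of U for the two connections correspond under the change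
    of vertical part from B to B + P v, and those of its image do so because P
    commutes with J. *)
Lemma eq_I1 D D' z (P : 'cV[R]_m -> 'M[R]_m) :
  (forall A B, vertical Q z A -> vertical Q z B -> vertical Q z (A + B)) ->
  (forall v, vertical Q z (P v) /\ vertical Q z (- P v)) ->
  (forall v, hlift Q D z v = hlift Q D' z v + vert (P v)) ->
  (forall v, P (z.2 *m v) = z.2 *m P v) ->
  forall U, I1 Q D z U = I1 Q D' z U.
Proof.
move=> vD vP hP PJ U; rewrite /I1; congr xget; apply/seteqP; split => U' /=.
  move=> [B [v [vB -> ->]]]; exists (B + P v), v; have [vPv _] := vP v.
  split; first exact: vD.
    by rewrite hP vertD addrA [in RHS]addrAC.
  by rewrite hP PJ mulmxDr vertD addrA [in RHS]addrAC.
move=> [B [v [vB -> ->]]]; exists (B - P v), v; have [_ vPv] := vP v.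
split; first exact: vD.
  by rewrite hP vertD vertN [X in _ = _ + X]addrC addrA subrK.
by rewrite hP PJ mulmxBr vertD vertN [X in _ = _ + X]addrC addrA subrK.
Qed.

Lemma vertical_linear W J z (k : R) (A B : 'M[R]_m) : W z.1 -> admissible_basis Q W J ->
  vertical Q z A -> vertical Q z B -> vertical Q z (A + k *: B).
Proof.
move=> Wz [_ _ _ QJ] [QA zA] [QB zB]; split.
  move: QA QB; rewrite QJ // => -[a ->] [b ->]; exists (fun i => a i + k * b i).
  exact: esym (imag_linear (J ^~ z.1) k a b).
rewrite mulmxDl mulmxDr -scalemxAl -scalemxAr addrACA zA add0r.
by rewrite -scalerDr zB scaler0.
Qed.

Lemma imag_first (I : 'I_3 -> 'M[R]_m) : I 0 = imag I (vec3 1 0 0).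
Proof. by rewrite /imag sum_ord3 !vec3E scale1r !scale0r !addr0. Qed.

(** The product of orthogonal imaginary quaternions is imaginary. *)
Lemma verticalJ W J z (A : 'M[R]_m) : (0 < m)%N -> W z.1 ->
  admissible_basis Q W J -> J 0 z.1 = z.2 ->
  vertical Q z A -> vertical Q z (z.2 *m A).
Proof.
move=> m0 Wz hJ Jz [QA zA]; have hT := admissible_triple hJ Wz.
have [_ _ _ QJ] := hJ; split; last by rewrite -mulmxA -mulmxDr zA mulmx0.
have [a Aa] : exists a, A = imag (J ^~ z.1) a by move: QA; rewrite QJ.
have a0 : a 0 = 0 by apply: (imag_anticomm m0 hT); rewrite -Aa Jz.
rewrite -Jz Aa (imag_first (J ^~ z.1)) imag_mul // (_ : dot3 _ _ = 0); last first.
  by rewrite /dot3 !vec3E a0; ring.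
by rewrite raddf0 subr0 QJ //; eexists.
Qed.

Lemma section_first W J : admissible_basis Q W J -> section_of Q W (J 0).
Proof.
move=> [sJ _ _ QJ]; split => // y Wy; rewrite QJ //; exists (vec3 1 0 0).
exact: (imag_first (J ^~ y)).
Qed.

End Twistor.

(** * Torsion and the difference of two quaternionic connections *)

Section Torsion.
Variables (R : realType) (m : nat) (M : manifold R m).
Implicit Types (W : set M) (x y : M).
Variables (g : M -> 'M[R]_m).

Lemma innerDl x u v w : inner g x (u + v) w = inner g x u w + inner g x v w.
Proof. by rewrite /inner linearD /= !mulmxDl mxE. Qed.

Lemma innerNl x u w : inner g x (- u) w = - inner g x u w.
Proof. by rewrite /inner linearN /= !mulNmx mxE. Qed.

Lemma inner_nondegenerate x v : riemannian g -> (forall w, inner g x v w = 0) -> v = 0.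
Proof.
move=> [_ _ gpos] v0; apply/eqP; apply: contraT => /(gpos x).
by rewrite v0 ltxx.
Qed.

(** Since J is an isometry with square -1, it moves to the other argument of
    g with a sign; the type condition on the trilinear form T then becomes the
    vanishing of a vector, as g is nondegenerate. *)
Lemma torsion_type_vec (D : connection M) Q W J (X Y : M -> 'cV[R]_m) x :
  riemannian g -> quaternion_hermitian Q g -> torsion_type_12_21 Q D g ->
  open W -> W x -> admissible_basis Q W J ->
  smooth_vec W X -> smooth_vec W Y ->
  let s := J 0 in let T := torsion D in
  T X Y x - T (fun y => s y *m X y) (fun y => s y *m Y y) x
  + s x *m T (fun y => s y *m X y) Y x + s x *m T X (fun y => s y *m Y y) x = 0.
Proof.
move=> hg hQg hT oW0 W0x hJ0 sX sY s T.
have [W1 [oW Wx W1W Wc]] := shrink_to_chart oW0 W0x.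
have hJ := admissible_basisS W1W hJ0.
have s2 : s x *m s x = - 1%:M by have [_ JJ _ _] := hJ0; exact: JJ.
have Qs : Q x (s x).
  by have [_ QJ0] := section_first hJ0; exact: QJ0.
apply: (inner_nondegenerate (x := x) hg) => w.
have sw : inner g x ^~ (s x *m w) =1 (fun v => - inner g x (s x *m v) w).
  move=> v; rewrite -(hQg x _ Qs s2) mulmxA s2 mulNmx mul1mx.
  by rewrite /inner mulmxN mxE.
have sZ := smooth_const_field w (chart_at_atlas x) oW Wc.
have := hT W1 J oW hJ 0 X Y _ (smooth_vecS W1W sX) (smooth_vecS W1W sY) sZ x Wx.
rewrite /torsion3 const_field_at /T /s.
(* Made opaque, since the torsion unfolds to a sum on which the additivity of
   g could be used. *)
move: (torsion D X Y x) (torsion D (fun y => J 0 y *m X y) (fun y => J 0 y *m Y y) x)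
  (torsion D (fun y => J 0 y *m X y) Y x) (torsion D X (fun y => J 0 y *m Y y) x)
  => T0 T1 T2 T3.
rewrite (sw T2) (sw T3) !innerDl innerNl => ->.
ring.
Qed.

(** For A the difference of the connections, T(X, Y) = A_X Y - A_Y X.  Once this
    is substituted in the hypothesis on T, every term cancels except those in
    which s is differentiated. *)
Lemma difference_symmetric (DT D0 : connection M) W (s : M -> 'M[R]_m)
    (BT B0 : 'cV[R]_m -> 'M[R]_m) (X Y : M -> 'cV[R]_m) x :
  open W -> W x -> smooth_endo W s -> s x *m s x = - 1%:M ->
  smooth_vec W X -> smooth_vec W Y -> torsion_free D0 ->
  (forall v, is_nabla_endo DT x v s (BT v)) ->
  (forall v, is_nabla_endo D0 x v s (B0 v)) ->
  let phi v : 'M[R]_m := BT v - B0 v in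
  let psi v : 'M[R]_m := phi (s x *m v) - s x *m phi v in
  let T := torsion DT in
  T X Y x - T (fun y => s y *m X y) (fun y => s y *m Y y) x
  + s x *m T (fun y => s y *m X y) Y x + s x *m T X (fun y => s y *m Y y) x = 0 ->
  psi (X x) *m Y x = psi (Y x) *m X x.
Proof.
move=> oW Wx ss s2 sX sY tf hBT hB0 phi psi T.
pose A v Z : 'cV[R]_m := nabla DT x v Z - nabla D0 x v Z.
have sV V : smooth_vec W V -> smooth_vec W (fun y => s y *m V y).
  by move=> hV; exact: smooth_vec_endo.
have TA U V : smooth_vec W U -> smooth_vec W V -> T U V x = A (U x) V - A (V x) U.
  move=> sU sV'; have := tf W U V oW sU sV' x Wx; rewrite /T /torsion /A.
  move: (nabla DT _ _ _) (nabla DT _ _ _) (nabla D0 _ _ _) (nabla D0 _ _ _) (bracket _ _ _).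
  move=> a b a0 b0 c /eqP; rewrite subr_eq0 => /eqP <-.
  by apply/colP => i; rewrite !mxE; ring.
have As v V : smooth_vec W V ->
    A v (fun y => s y *m V y) = phi v *m V x + s x *m A v V.
  move=> sV'; rewrite /A (hBT v W V oW Wx sV') (hB0 v W V oW Wx sV').
  by rewrite /phi mulmxBl mulmxBr opprD addrACA.
have sX1 := sV X sX; have sY1 := sV Y sY.
rewrite (TA _ _ sX sY) (TA _ _ sX1 sY1) (TA _ _ sX1 sY) (TA _ _ sX sY1).
rewrite !(As _ X sX) !(As _ Y sY) /psi.
have ssK (v : 'cV[R]_m) : s x *m (s x *m v) = - v by rewrite mulmxA s2 mulNmx mul1mx.
clearbody phi A.
rewrite !mulmxBl -!mulmxA.
move: (A (X x) Y) (A (Y x) X) (A (s x *m X x) Y) (A (s x *m Y x) X).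
move: (phi (s x *m X x) *m Y x) (phi (s x *m Y x) *m X x) (phi (X x) *m Y x) (phi (Y x) *m X x).
move=> p1 p2 q1 q2 a1 a2 a3 a4.
rewrite !mulmxBr !mulmxDr !ssK.
move: (s x *m a3) (s x *m a4) (s x *m q1) (s x *m q2) => b3 b4 r1 r2 h.
apply/subr0_eq; rewrite -[RHS]oppr0 -h.
by apply/colP => i; rewrite !mxE; ring.
Qed.

(** The defect psi of J-linearity is vertical at each vector, so the symmetry of
    (psi v) w at w = J 1 v is the situation of [imag_anticomm_eq0]. *)
Lemma difference_J_linear (DT D0 : connection M) Q W (J : 'I_3 -> M -> 'M[R]_m)
    (BT B0 : 'cV[R]_m -> 'M[R]_m) (z : M * 'M[R]_m) :
  (0 < m)%N -> riemannian g -> quaternion_hermitian Q g ->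
  torsion_type_12_21 Q DT g -> torsion_free D0 ->
  open W -> W z.1 -> admissible_basis Q W J -> J 0 z.1 = z.2 ->
  (forall v, is_nabla_endo DT z.1 v (J 0) (BT v)) ->
  (forall v, is_nabla_endo D0 z.1 v (J 0) (B0 v)) ->
  (forall v, vertical Q z (BT v - B0 v)) ->
  forall v, BT (z.2 *m v) - B0 (z.2 *m v) = z.2 *m (BT v - B0 v).
Proof.
case: z => x A /= m0 hg hQg hT tf oW Wx hJ Jx hBT hB0 vphi v.
have triJ := admissible_triple hJ Wx; have [sJ JJ _ QJ] := hJ.
have [->|nv] := eqVneq v 0.
  rewrite !mulmx0 (is_nabla_endo_unique (hBT 0) (is_nabla_endo_dir0 DT oW Wx (sJ 0))).
  rewrite (is_nabla_endo_unique (hB0 0) (is_nabla_endo_dir0 D0 oW Wx (sJ 0))).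
  by rewrite subrr mulmx0.
pose psi w : 'M[R]_m := BT (A *m w) - B0 (A *m w) - A *m (BT w - B0 w).
apply/subr0_eq; rewrite -/(psi v).
have psiQ w : (exists a, psi w = imag (J ^~ x) a) /\
    psi w *m J 0 x + J 0 x *m psi w = 0.
  have [Qpsi anti] : vertical Q (x, A) (psi w).
    rewrite (_ : psi w = BT (A *m w) - B0 (A *m w) + (-1) *: (A *m (BT w - B0 w))).
      apply: (@vertical_linear _ _ _ _ W J) => //=.
      exact: (@verticalJ _ _ _ _ W J (x, A)).
    by rewrite scaleN1r.
  by split; [move: Qpsi; rewrite QJ|rewrite Jx].
have sym w : psi v *m w = psi w *m v.
  have [W1 [oW1 W1x W1W W1c]] := shrink_to_chart oW Wx.
  have hJ1 := admissible_basisS W1W hJ.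
  have sX := smooth_const_field v (chart_at_atlas x) oW1 W1c.
  have sY := smooth_const_field w (chart_at_atlas x) oW1 W1c.
  have := difference_symmetric oW1 W1x (smooth_endoS W1W (sJ 0)) (JJ x Wx 0) sX sY
    tf hBT hB0 (torsion_type_vec hg hQg hT oW1 W1x hJ1 sX sY).
  by rewrite !const_field_at Jx.
have [ex1 anti1] := psiQ v; have [ex2 anti2] := psiQ (J 1 x *m v).
exact: (imag_anticomm_eq0 m0 triJ ex1 ex2 anti1 anti2 nv (sym _)).
Qed.

End Torsion.

Theorem theorem4p1 (R : realType) (n : nat) (hn : (0 < n)%N)
    (M : manifold R (4 * n)%N) (Q : M -> set 'M[R]_(4 * n))
    (g : M -> 'M[R]_(4 * n)) (DT D0 : connection M)
    (hQ : almost_quaternionic Q)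
    (hg : riemannian g)
    (hQg : quaternion_hermitian Q g)
    (hDT : QKT_connection Q g DT)
    (hD0 : quaternionic_connection Q D0)
    (hD0_torsion_free : torsion_free D0) :
  forall z : M * 'M[R]_(4 * n), twistor_space Q z ->
  forall U : tan_endo R (4 * n)%N, tangent_twistor Q z U ->
    I1 Q DT z U = I1 Q D0 z U.
Proof.
move=> z [Qz z2] U _.
have m0 : (0 < 4 * n)%N by rewrite muln_gt0.
have [W [J [oW Wz hJ Jz]]] := admissible_basis_through m0 hQ Qz z2.
have [sJ JJ _ _] := hJ; have secJ := section_first hJ.
have [quatT _ _ typeT] := hDT.
have /choice[BT hBT] : forall v, exists B, Q z.1 B /\ is_nabla_endo DT z.1 v (J 0) B.
  by move=> v; have [B QB hB] := quatT W _ oW secJ z.1 v Wz; exists B.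
have /choice[B0 hB0] : forall v, exists B, Q z.1 B /\ is_nabla_endo D0 z.1 v (J 0) B.
  by move=> v; have [B QB hB] := hD0 W _ oW secJ z.1 v Wz; exists B.
have vertB D (B : 'cV[R]_(4 * n) -> 'M[R]_(4 * n)) v :
    (forall v, Q z.1 (B v) /\ is_nabla_endo D z.1 v (J 0) (B v)) -> vertical Q z (B v).
  move=> hB; have [QB dB] := hB v; split => //; rewrite -Jz.
  by apply: (is_nabla_endo_anticomm oW Wz (sJ 0) _ dB) => y Wy; exact: JJ.
have vertBB v : vertical Q z (BT v - B0 v).
  rewrite -scaleN1r; apply: (vertical_linear _ Wz hJ); first exact: vertB hBT.
  exact: vertB hB0.
have liftB D (B : 'cV[R]_(4 * n) -> 'M[R]_(4 * n)) v :
    (forall v, Q z.1 (B v) /\ is_nabla_endo D z.1 v (J 0) (B v)) ->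
    hlift Q D z v = diff_section (J 0) z.1 v - vert (B v).
  by move=> hB; have [QB dB] := hB v; exact: hliftE hJ secJ Jz QB dB.
apply: (eq_I1 (P := fun v => - (BT v - B0 v))).
- by move=> A B vA vB; rewrite -[B]scale1r; exact: (vertical_linear _ Wz hJ).
- move=> v; rewrite opprK; split => //.
  rewrite [X in vertical Q z X](_ : _ = BT v - B0 v + (- 2%:R) *: (BT v - B0 v)).
    exact: (vertical_linear _ Wz hJ).
  by rewrite -{2}[BT v - B0 v]scale1r -scalerDl (_ : 1 - 2%:R = -1) ?scaleN1r //; ring.
- move=> v; rewrite (liftB _ _ _ hBT) (liftB _ _ _ hB0) -addrA; congr (_ + _).
  by rewrite -!vertN -vertD opprB addKr.
move=> v; rewrite mulmxN; congr (- _).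
exact: (difference_J_linear m0 hg hQg typeT hD0_torsion_free oW Wz hJ Jz
  (fun v => (hBT v).2) (fun v => (hB0 v).2) vertBB).
Qed.
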